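(* Let $1\le d\le k$. Then $$\mathfrak M_{[2k+1,2d]}(x)=1+xR_k(x^2).$$
   Context: $\mathfrak S_n$ is the set of permutations of $\{1,\dots,n\}$ (for $n=0$, the empty permutation, which is even). A permutation avoids a pattern $\tau$ of length $\ell$ if none of its length-$\ell$ subsequences is order-isomorphic to $\tau$. For $1\le d\le k$, $[k,d]$ denotes the pattern $(d+1)(d+2)\ldots k\,1\,2\ldots d\in\mathfrak S_k$. $\mathfrak M_\tau(x)=\mathfrak E_\tau(x)-\mathfrak O_\tau(x)$, where $\mathfrak E_\tau(x)$ (resp. $\mathfrak O_\tau(x)$) is the ordinary generating function in $n$ for the number of even (resp. odd) permutations in $\mathfrak S_n$, $n\ge0$, avoiding both $132$ and $\tau$. $U_r$ is the Chebyshev polynomial of the second kind: $U_0(t)=1$, $U_1(t)=2t$, $U_r(t)=2tU_{r-1}(t)-U_{r-2}(t)$. For $k\ge1$, $R_k(x)=\dfrac{U_{k-1}\left(\frac1{2\sqrt x}\right)}{\sqrt x\,U_k\left(\frac1{2\sqrt x}\right)}$, a rational function of $x$; equivalently $R_1(x)=1$ and $R_k(x)=1/(1-xR_{k-1}(x))$ for $k\ge2$. *)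

(* Defs.v *)
From mathcomp Require Import all_boot all_order all_fingroup all_algebra.
From mathcomp Require Import boolp classical_sets.
From mathcomp Require Import ring.

Set Implicit Arguments.
Unset Strict Implicit.
Unset Printing Implicit Defensive.

Import GRing.Theory.
Local Open Scope ring_scope.

(* Permutations of {1, ..., n} are elements of 'S_n, i.e. both positions and
   values are shifted by one; a pattern is given by its one-line notation. *)
Definition contains (n : nat) (s : 'S_n) (tau : seq nat) : bool :=
  [exists f : {ffun 'I_(size tau) -> 'I_n},
    [forall i : 'I_(size tau), forall j : 'I_(size tau), (i < j)%N ==> (f i < f j)%N] &&
    [forall i : 'I_(size tau), forall j : 'I_(size tau),
      (s (f i) < s (f j))%N == (nth 0%N tau i < nth 0%N tau j)%N]].

Definition avoids (n : nat) (s : 'S_n) (tau : seq nat) : bool :=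
  ~~ contains s tau.

Definition pat132 : seq nat := [:: 1; 3; 2]%N.

(* [k, d] = (d+1) (d+2) ... k 1 2 ... d *)
Definition pat (k d : nat) : seq nat := iota d.+1 (k - d) ++ iota 1 d.

(* A formal power series over rat is its sequence of coefficients. *)
Definition even_gf (tau : seq nat) (n : nat) : rat :=
  #|[set s : 'S_n | [&& ~~ odd_perm s, avoids s pat132 & avoids s tau]]|%:R.

Definition odd_gf (tau : seq nat) (n : nat) : rat :=
  #|[set s : 'S_n | [&& odd_perm s, avoids s pat132 & avoids s tau]]|%:R.

Definition M_gf (tau : seq nat) (n : nat) : rat :=
  even_gf tau n - odd_gf tau n.

Notation ratfun := {fraction {poly rat}}.

Definition varX : ratfun := tofrac 'X.

(* The formal power series with coefficients a is the expansion at 0 of the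
   rational function r: r = p / q with q(0) <> 0 and q * a = p as series. *)
Definition series_eq_ratfun (a : nat -> rat) (r : ratfun) : Prop :=
  exists p q : {poly rat},
    [/\ q`_0 != 0, r = tofrac p / tofrac q &
        forall n : nat, \sum_(i < n.+1) q`_i * a (n - i)%N = p`_n].

Lemma series_eq_ratfun_uniq (a b : nat -> rat) (r : ratfun) :
  series_eq_ratfun a r -> series_eq_ratfun b r -> a =1 b.
Proof.
move=> [p [q [q0 -> Ha]]] [p' [q' [q'0 e Hb]]] n.
have nz (u : {poly rat}) : u`_0 != 0 -> tofrac u != 0.
  by rewrite tofrac_eq0; apply: contraNneq => ->; rewrite coef0.
have epq : p * q' = p' * q.
  apply/eqP; rewrite -tofrac_eq !tofracM.
  by rewrite -eqr_div ?nz //; apply/eqP.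
pose A (c : nat -> rat) := \poly_(i < n.+1) c i.
have trunc c (u v : {poly rat}) m : (m < n.+1)%N ->
    (forall i : nat, \sum_(j < i.+1) u`_j * c (i - j)%N = v`_i) ->
    (u * A c)`_m = v`_m.
  move=> mn Hc; rewrite coefM -Hc; apply: eq_bigr => j _.
  by rewrite coef_poly (leq_ltn_trans (leq_subr _ _) mn).
have prodE (u v w : {poly rat}) m : (m < n.+1)%N ->
    (forall i, (i < n.+1)%N -> u`_i = v`_i) -> (w * u)`_m = (w * v)`_m.
  move=> mn uv; rewrite !coefM; apply: eq_bigr => j _.
  by rewrite uv // (leq_ltn_trans (leq_subr _ _) mn).
have H m : (m < n.+1)%N -> ((q * q') * A a)`_m = ((q * q') * A b)`_m.
  move=> mn.
  rewrite [q * q']mulrC -!mulrA (prodE _ p) // => [|i ni]; last exact: trunc.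
  rewrite mulrCA (prodE (q' * A b) p') // => [|i ni]; last exact: trunc.
  by rewrite mulrC epq mulrC.
have Q0 : (q * q')`_0 != 0 by rewrite coef0M mulf_neq0.
have E m : (m < n.+1)%N -> a m = b m.
  elim/ltn_ind: m => m IH mn.
  have := H m mn; rewrite !coefM !big_ord_recl /= !subn0 !coef_poly mn.
  rewrite (eq_bigr (fun i : 'I_m => (q * q')`_(lift ord0 i) *
     (A b)`_(m - lift ord0 i))) => [/addIr/(mulfI Q0)//|i _].
  have lm : (m - lift ord0 i < m)%N.
    by rewrite ltn_subrL /= /bump (leq_ltn_trans _ (ltn_ord i)).
  by rewrite !coef_poly (ltn_trans lm mn) IH // (ltn_trans lm mn).
exact: E.
Qed.

Fixpoint chebU (A : comNzRingType) (r : nat) : {poly A} :=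
  match r with
  | 0 => 1
  | 1 => 2%:R * 'X
  | (r''.+1 as r').+1 => 2%:R * 'X * chebU A r' - chebU A r''
  end.

(* A square root of x if x is a square in K (junk value 0 otherwise). *)
Definition sqrtK (K : fieldType) (x : K) : K :=
  xget 0 [set s : K | s ^+ 2 = x]%classic.

(* R_k(x), meaningful when x is a square in K; the choice of the square root
   is then irrelevant (chebRE). *)
Definition chebR (K : fieldType) (k : nat) (x : K) : K :=
  let s := sqrtK x in
  let t := (2%:R * s)^-1 in
  (chebU K k.-1).[t] / (s * (chebU K k).[t]).

Lemma chebU_horner (A : comNzRingType) (t : A) :
  [/\ (chebU A 0).[t] = 1, (chebU A 1).[t] = 2%:R * t &
      forall r, (chebU A r.+2).[t] =
        2%:R * t * (chebU A r.+1).[t] - (chebU A r).[t]].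
Proof.
split=> [||r]; first by rewrite hornerE.
  by rewrite [chebU _ _]/= -polyC_natr !hornerE.
rewrite [chebU _ _](_ : _ = 2%:R * 'X * chebU A r.+1 - chebU A r) //.
by rewrite -polyC_natr !hornerE.
Qed.

Arguments chebU : simpl never.

Lemma chebUN (A : comNzRingType) (r : nat) (t : A) :
  (chebU A r).[- t] = (-1) ^+ r * (chebU A r).[t].
Proof.
have [U0 U1 US] := chebU_horner t; have [V0 V1 VS] := chebU_horner (- t).
have [] : (chebU A r).[- t] = (-1) ^+ r * (chebU A r).[t] /\
          (chebU A r.+1).[- t] = (-1) ^+ r.+1 * (chebU A r.+1).[t] => //.
elim: r => [|r [IH1 IH2]].
  by rewrite U0 V0 U1 V1 expr0 expr1 mul1r mulN1r mulrN.
by split=> //; rewrite US VS IH1 IH2 !exprS; ring.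
Qed.

Lemma chebRE (K : fieldType) (k : nat) (s : K) : (0 < k)%N ->
  chebR k (s ^+ 2) =
  (chebU K k.-1).[(2%:R * s)^-1] / (s * (chebU K k).[(2%:R * s)^-1]).
Proof.
case: k => // k _; rewrite /chebR /sqrtK [k.+1.-1]/=.
case: xgetP => [s1 _ /= /eqP|/(_ s) []//].
rewrite eqf_sqr => /orP[/eqP-> //|/eqP->].
rewrite mulrN invrN !chebUN.
move: (chebU K k).[_] (chebU K k.+1).[_] => u v.
have -> : - s * ((-1) ^+ k.+1 * v) = (-1) ^+ k * (s * v) by rewrite exprS; ring.
by rewrite -mulf_div divff ?signr_eq0 // mul1r.
Qed.

Lemma chebR1 (K : fieldType) (s : K) : 2%:R != 0 :> K -> s != 0 ->
  chebR 1 (s ^+ 2) = 1.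
Proof.
move=> n2 s0; rewrite chebRE // [1.-1]/=.
have [-> -> _] := chebU_horner (2%:R * s)^-1.
by field; rewrite s0 n2 oner_neq0.
Qed.

Lemma chebRS (K : fieldType) (k : nat) (s : K) : (0 < k)%N ->
  2%:R != 0 :> K -> s != 0 -> (chebU K k).[(2%:R * s)^-1] != 0 ->
  chebR k.+1 (s ^+ 2) = (1 - s ^+ 2 * chebR k (s ^+ 2))^-1.
Proof.
case: k => // k _ n2 s0 Uk; rewrite !chebRE // [k.+2.-1]/= [k.+1.-1]/=.
have -> : s * (chebU K k.+2).[(2%:R * s)^-1] =
    (chebU K k.+1).[(2%:R * s)^-1] - s * (chebU K k).[(2%:R * s)^-1].
  have [_ _ ->] := chebU_horner (2%:R * s)^-1.
  by field; rewrite s0 n2.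
move: Uk; set u := (_).[_] => Uk; set v := (_).[_].
rewrite -[u / _]invf_div; congr (_^-1).
by field; rewrite s0 Uk.
Qed.

(* Main.v *)
Require Import Defs.
From HB Require Import structures.
From mathcomp Require Import all_boot all_order all_fingroup all_algebra.
From mathcomp Require Import boolp ring zify.
Import GRing.Theory.
Local Open Scope ring_scope.

(** The signed count of the permutations avoiding 132 and [2k+1, 2d] is computed
by the classical decomposition around the largest entry.  A permutation avoids
132 exactly when it reads l' n r, with l' and r avoiding 132 and every entry
of l' above every entry of r ([occurs_132_split]).  If l' has a entries and r
has b, this adds b * (a + 1) inversions to those of l' and r.

The other patterns follow the same decomposition.  An increasing sequence of
length at least 2 lies in r, or in l' with n as a possible last entry.  For
d > 0, the pattern [c + 1 + d, d] has c + 1 large increasing entries followed by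
d small increasing ones; it occurs in l' n r iff it occurs in l', or in r, or
l' has an increasing subsequence of length c (completed by n) and r one of
length d ([occurs_inc_split], [occurs_block_split]).  For signed generating
functions, write B for the product twisted by (-1)^(b (a + 1)), and L_m for the
series of permutations avoiding 132 and 12...m.  Then L_0 = 0, as the empty
pattern occurs everywhere, L_(m+1) = 1 + x B(L_m, L_(m+1)), and with e = k - d
the series M of the theorem satisfies
  M = 1 + x (B(L_2e, M) + B(M, L_2d) - B(L_2e, L_2d)).

The sign (-1)^(b (a + 1)) depends only on the parities of a and b, so
splitting every series into its even and odd parts turns B into ordinary
products ([even_part_twist], [odd_part_twist]).  What remains is linear algebra
over power series.  Let P_k / Q_k be the fraction R_k(x^2), with P_(k+1) = Q_k and
Q_(k+1) = Q_k - x^2 P_k.  By induction L_(2e+1) = 1 + x P_e / Q_e, while L_2e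
has even and odd parts P_e Q_e / D_e and x P_e^2 / D_e, where
D_e = Q_e^2 + x^2 P_e^2 ([increasing_parts]).  The equation for M is then an
invertible 2 x 2 system for the two parts of M, solved by 1 and
x (P_e Q_d + Q_e P_d - P_e P_d) / (Q_e Q_d - x^2 P_e P_d).  By the addition
formula for convergents ([cf_add]) the latter is x P_k / Q_k with k = e + d,
which explains why the answer does not depend on d ([block_parts]). *)

Local Open Scope nat_scope.

(** * Occurrences of patterns in words *)

Definition order_iso (t tau : seq nat) : Prop :=
  size t = size tau /\ forall i j, i < size tau -> j < size tau ->
    (nth 0 t i < nth 0 t j) = (nth 0 tau i < nth 0 tau j).

Definition occurs (tau w : seq nat) : bool :=
  `[< exists2 t, subseq t w & order_iso t tau >].

Lemma occursP tau w :
  reflect (exists2 t, subseq t w & order_iso t tau) (occurs tau w).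
Proof. exact: asboolP. Qed.

Definition word {n : nat} (s : 'S_n) : seq nat := [seq val (s i) | i <- enum 'I_n].

(** A strictly increasing list of positions is a subsequence of the list of all
positions; this turns the embeddings of [contains] into subsequences. *)
Lemma subseq_enum_ord n (t : seq 'I_n) :
  sorted (fun i j : 'I_n => i < j) t -> subseq t (enum 'I_n).
Proof.
set lt := fun i j : 'I_n => i < j => st.
have lt_tr : transitive lt by move=> i j k; apply: ltn_trans.
have lt_irr : irreflexive lt by move=> i; apply: ltnn.
have s_enum : sorted lt (enum 'I_n).
  by have := iota_ltn_sorted 0 n; rewrite -val_enum_ord sorted_map.
apply/(subseq_uniqP (enum_uniq _)).
apply: (irr_sorted_eq lt_tr lt_irr) => //; first exact: sorted_filter.
by move=> i; rewrite mem_filter mem_enum andbT.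
Qed.

Lemma nth_map_enum n (f : 'I_n -> nat) i (hi : i < n) :
  nth 0 [seq f j | j <- enum 'I_n] i = f (Ordinal hi).
Proof.
rewrite (nth_map (Ordinal hi)) ?size_enum_ord //; congr f; apply: val_inj.
by rewrite /= nth_enum_ord.
Qed.

(** An increasing embedding of positions is the same thing as the subsequence that
it selects. *)
Lemma contains_word n (s : 'S_n) tau : contains s tau = occurs tau (word s).
Proof.
apply/existsP/occursP => [[f /andP[/forallP mono /forallP iso]]|].
  exists [seq val (s (f i)) | i <- enum 'I_(size tau)].
    rewrite (map_comp (fun i => val (s i)) f); apply: map_subseq.
    apply: subseq_enum_ord; rewrite sorted_map.
    have := iota_ltn_sorted 0 (size tau); rewrite -val_enum_ord sorted_map.
    by apply: sub_sorted => i j /= ij; apply: (implyP (forallP (mono i) j)).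
  split=> [|i j hi hj]; first by rewrite size_map size_enum_ord.
  by rewrite !nth_map_enum; exact: (eqP (forallP (iso (Ordinal hi)) (Ordinal hj))).
move=> [t /subseqP[m szm ->]]; rewrite /word -map_mask.
set t0 := mask m _ => -[szt iso].
rewrite size_map in szt.
have st0 : sorted (fun i j : 'I_n => i < j) t0.
  apply: sorted_mask => [i j k|]; first exact: ltn_trans.
  by have := iota_ltn_sorted 0 n; rewrite -val_enum_ord sorted_map.
pose T := @Tuple _ _ t0 (introT eqP szt).
exists [ffun i => tnth T i]; apply/andP; split.
  apply/forallP => i; apply/forallP => j; apply/implyP => ij; rewrite !ffunE.
  have x0 : 'I_n := tnth T i.
  rewrite !(tnth_nth x0) /=.
  apply: (sorted_ltn_nth _ _ st0) => //; rewrite ?inE ?szt //.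
  by move=> ? ? ?; apply: ltn_trans.
apply/forallP => i; apply/forallP => j; rewrite !ffunE -(iso i j) //.
have x0 : 'I_n := tnth T i.
by rewrite !(nth_map x0) ?szt // !(tnth_nth x0).
Qed.

Lemma sorted_ltn_nthE (u : seq nat) i j : sorted ltn u -> i < size u -> j < size u ->
  (nth 0 u i < nth 0 u j) = (i < j).
Proof.
move=> su iu ju.
have H k k' : k < k' -> k' < size u -> nth 0 u k < nth 0 u k'.
  move=> kk' k'u; apply: (sorted_ltn_nth ltn_trans 0 su) => //.
  by rewrite inE; apply: ltn_trans k'u.
case: (ltngtP i j) => [ij|ji|->]; [by rewrite H| |by rewrite ltnn].
by apply: negbTE; rewrite -leqNgt ltnW // H.
Qed.

(** Among the words isomorphic to [c + d, d] the relative order is fixed by three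
facts: both blocks increase, and the first lies above the second. *)
Lemma order_iso_block t c d :
  order_iso t (pat (c + d) d) <->
  exists u v, [/\ t = u ++ v, size u = c /\ size v = d, sorted ltn u, sorted ltn v
               & {in u & v, forall x y, y < x}].
Proof.
rewrite /pat addnK; split=> [[sz iso]|[u [v [-> [<- <-] su sv uv]]]].
  move: sz iso; rewrite size_cat !size_iota => sz iso.
  have N i : i < c + d -> nth 0 (iota d.+1 c ++ iota 1 d) i =
      if i < c then d.+1 + i else (i - c).+1.
    move=> icd; rewrite nth_cat size_iota; case: ifP => ic; first by rewrite nth_iota.
    by rewrite nth_iota ?add1n // ltn_subLR // leqNgt ic.
  have st : size (take c t) = c by rewrite size_takel // sz leq_addr.
  have sd : size (drop c t) = d by rewrite size_drop sz addKn.
  exists (take c t), (drop c t); split; first by rewrite cat_take_drop.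
  - by [].
  - apply/(sortedP 0) => i; rewrite st => ic.
    have ic' := ltnW ic.
    rewrite !nth_take //= iso ?N ?ic ?ic' ?ltn_add2l //; exact: ltn_addr.
  - apply/(sortedP 0) => i; rewrite sd => ic.
    rewrite !nth_drop /= iso ?ltn_add2l ?(ltnW ic) // !N ?ltn_add2l ?(ltnW ic) //.
    by do 2 case: ifP; lia.
  - move=> x y /(nthP 0)[i + <-] /(nthP 0)[j + <-]; rewrite st sd => ic jd.
    rewrite nth_take // nth_drop iso ?ltn_add2l //; last exact: ltn_addr.
    rewrite !N ?ltn_add2l ?ic //; last exact: ltn_addr.
    by case: ifP; lia.
split=> [|i j]; first by rewrite !size_cat !size_iota.
rewrite size_cat !size_iota => hi hj.
rewrite !nth_cat size_iota.
case: (ltnP i (size u)) => iu; case: (ltnP j (size u)) => ju.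
- by rewrite sorted_ltn_nthE // !nth_iota // ltn_add2l.
- have jv : j - size u < size v by rewrite ltn_subLR.
  rewrite !nth_iota //.
  have h := uv _ _ (mem_nth 0 iu) (mem_nth 0 jv).
  by rewrite ltnNge (ltnW h) /=; apply/esym/negbTE; rewrite -leqNgt; lia.
- have iv : i - size u < size v by rewrite ltn_subLR.
  rewrite !nth_iota // uv ?mem_nth //; apply/esym; lia.
have iv : i - size u < size v by rewrite ltn_subLR.
have jv : j - size u < size v by rewrite ltn_subLR.
by rewrite sorted_ltn_nthE // !nth_iota //= ltn_add2l.
Qed.

Lemma order_iso_inc t m : order_iso t (iota 1 m) <-> sorted ltn t /\ size t = m.
Proof.
have -> : iota 1 m = pat (m + 0) 0 by rewrite /pat addn0 subn0 cats0.
split=> [/order_iso_block[u [v [-> [sz /size0nil ->]]]]|[st sz]].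
  by rewrite cats0.
by apply/order_iso_block; exists t, [::]; rewrite cats0.
Qed.

Lemma order_iso_132 t : order_iso t pat132 <->
  exists x y z, [/\ t = [:: x; y; z], x < z & z < y].
Proof.
split=> [[+ iso]|[x [y [z [-> xz zy]]]]].
  case: t iso => [|x [|y [|z []]]] //= iso _; exists x, y, z; split=> //.
    by rewrite (iso 0 2).
  by rewrite (iso 2 1).
by split=> // -[|[|[|i]]] [|[|[|j]]] //= _ _; lia.
Qed.

Lemma subseq_catP (T : eqType) (t l r : seq T) :
  subseq t (l ++ r) <-> exists t1 t2, [/\ t = t1 ++ t2, subseq t1 l & subseq t2 r].
Proof.
split=> [/subseqP[m szm ->]|[t1 [t2 [-> ]]]]; last exact: cat_subseq.
exists (mask (take (size l) m) l), (mask (drop (size l) m) r).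
rewrite !mask_subseq -mask_cat ?cat_take_drop //.
by rewrite size_takel // szm size_cat leq_addr.
Qed.

Lemma occurs_sub tau w w' : subseq w w' -> occurs tau w -> occurs tau w'.
Proof.
by move=> ww' /occursP[t tw iso]; apply/occursP; exists t => //; apply: subseq_trans ww'.
Qed.

Lemma occurs_inc_leq m m' w : m <= m' -> occurs (iota 1 m') w -> occurs (iota 1 m) w.
Proof.
move=> mm' /occursP[t tw /order_iso_inc[st sz]]; apply/occursP.
exists (take m t); first exact: subseq_trans (take_subseq _ _) tw.
by apply/order_iso_inc; rewrite take_sorted // size_takel ?sz.
Qed.

Lemma occurs_inc_of m t w : subseq t w -> sorted ltn t -> m <= size t ->
  occurs (iota 1 m) w.
Proof.
move=> tw st mt; apply: (occurs_inc_leq m (size t)) => //.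
by apply/occursP; exists t => //; apply/order_iso_inc.
Qed.

(** * Patterns in a word l ++ top :: r with l above r *)

Section Split.
Variables (l r : seq nat) (top : nat).
Hypothesis l_top : {in l, forall x, x < top}.
Hypothesis r_top : {in r, forall x, x < top}.
Hypothesis lr : {in l & r, forall x y, y < x}.

Lemma subseq_cons_lt t b : subseq t (top :: r) -> {in t, forall x, x < b} -> b <= top ->
  subseq t r.
Proof.
case: t => [|x t] //= st xb btop; first by case: (r).
move: st; case: eqP => // xtop; have := xb x (mem_head _ _); lia.
Qed.

(** No increasing sequence can pass from [l] down to [r]: after an entry of [l] only
[top] may follow, and nothing follows [top]. *)
Lemma sorted_split t1 t2 : sorted ltn (t1 ++ t2) -> subseq t1 l -> subseq t2 (top :: r) ->
  [\/ t1 = [::] /\ subseq t2 r, t2 = [::] | t2 = [:: top]].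
Proof.
case: t2 => [|y t2] st t1l t2r; first by constructor 2.
have yr : y <> top -> y \in r.
  by move=> yt; have := mem_subseq t2r (mem_head y t2); rewrite inE => /orP[/eqP|].
have [ytop|ytop] := eqVneq y top.
  case: t2 t2r st => [|z t2] t2r st; first by constructor 3; rewrite ytop.
  have zr : z \in r.
    by move: t2r; rewrite ytop /= eqxx => /mem_subseq -> //; rewrite mem_head.
  move: st; rewrite (sorted_pairwise ltn_trans) pairwise_cat => /and3P[_ _] /=.
  by rewrite ytop => /andP[/andP[]]; have := r_top z zr; lia.
case: t1 st t1l => [|x t1] st t1l.
  by constructor 1; split=> //; move: t2r; rewrite /= (negbTE ytop).
move: st; rewrite (sorted_pairwise ltn_trans) pairwise_cat allrel_consl /=.
move=> /andP[/andP[/andP[+ _] _] _].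
have := lr x y (mem_subseq t1l (mem_head _ _)) (yr (elimN eqP ytop)); lia.
Qed.

(** An increasing subsequence either lives in [r], or lives in [l] up to a final
[top], which can always be appended. *)
Lemma occurs_inc_split m : occurs (iota 1 m.+1) (l ++ top :: r) =
  occurs (iota 1 m) l || occurs (iota 1 m.+1) r.
Proof.
apply/idP/orP=> [/occursP[t /subseq_catP[t1 [t2 [-> t1l t2r]]]]|[]].
- move=> /order_iso_inc[st sz]; have st1 := cat_sorted2 st.
  case: (sorted_split _ _ st t1l t2r) => [[t10 t2r']|t20|t2top].
  + by right; apply: (occurs_inc_of _ t2) => //; [case: st1|rewrite -sz t10].
  + by left; apply: (occurs_inc_of _ t1) => //; [case: st1|move: sz; rewrite t20 cats0 => ->].
  + left; apply: (occurs_inc_of _ t1) => //; first by case: st1.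
    by move: sz; rewrite t2top size_cat addn1 => -[<-].
- move=> /occursP[t tl /order_iso_inc[st sz]].
  apply: (occurs_inc_of _ (t ++ [:: top])).
  + by apply: cat_subseq => //=; rewrite eqxx sub0seq.
  + rewrite (sorted_pairwise ltn_trans) pairwise_cat -(sorted_pairwise ltn_trans) st.
    rewrite allrel1r /= andbT; apply/allP => x xt; apply: l_top; exact: (mem_subseq tl).
  + by rewrite size_cat addn1 sz.
- by apply: occurs_sub; apply: subseq_trans (suffix_subseq _ _); apply: subseq_cons.
Qed.

(** An occurrence not confined to [l] or to [r] has its upper block in [l] (with
[top] as a possible last entry) and its lower block in [r]: an increasing block
cannot straddle [l] and [r], and a lower block cannot contain [top]. *)
Lemma occurs_block_split c d :
  occurs (pat (c.+1 + d.+1) d.+1) (l ++ top :: r) =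
  [|| occurs (pat (c.+1 + d.+1) d.+1) l, occurs (pat (c.+1 + d.+1) d.+1) r
    | occurs (iota 1 c) l && occurs (iota 1 d.+1) r].
Proof.
apply/idP/or3P=> [/occursP[t /[swap]]|[]]; last first.
- move=> /andP[/occursP[a al /order_iso_inc[sa sza]] /occursP[b br /order_iso_inc[sb szb]]].
  apply/occursP; exists (a ++ top :: b); first by apply: cat_subseq => //=; rewrite eqxx.
  apply/order_iso_block; exists (rcons a top), b; split=> //.
  + by rewrite cat_rcons.
  + by rewrite size_rcons sza.
  + rewrite -cats1 (sorted_pairwise ltn_trans) pairwise_cat -(sorted_pairwise ltn_trans) sa.
    by rewrite allrel1r /= andbT; apply/allP => x xt; apply: l_top; exact: (mem_subseq al).
  + move=> x y; rewrite mem_rcons inE => /orP[/eqP -> | xa] yb.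
      by apply: r_top; apply: (mem_subseq br).
    by apply: lr; [apply: (mem_subseq al)|apply: (mem_subseq br)].
- by apply: occurs_sub; apply: subseq_trans (suffix_subseq _ _); apply: subseq_cons.
- by apply: occurs_sub; apply: prefix_subseq.
move=> iso; have /order_iso_block[u [v [tuv [szu szv] su sv uv]]] := iso.
move=> /subseq_catP[t1 [t2 [tE t1l t2r]]].
have t_top x : x \in u ++ v -> x <= top.
  rewrite -tuv tE mem_cat => /orP[/(mem_subseq t1l)/l_top/ltnW //|/(mem_subseq t2r)].
  by rewrite inE => /orP[/eqP->//|/r_top/ltnW].
case: u => [//|x u] in szu su uv tuv t_top *.
have v_top : {in v, forall y, y < top}.
  move=> y yv; apply: (@leq_trans x); first by apply: uv => //; rewrite mem_head.
  by apply: t_top; rewrite mem_head.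
have [le1|lt1] := leqP (size (x :: u)) (size t1).
  (* The upper block is used up within l, so the lower block starts there or in
     top :: r. *)
  have t1E : t1 = (x :: u) ++ drop (size (x :: u)) t1.
    rewrite -{1}(cat_take_drop (size (x :: u)) t1); congr (_ ++ _).
    by rewrite -(takel_cat t2) // -tE tuv take_size_cat.
  move: t1E; set v1 := drop _ t1 => t1E.
  have vE : v = v1 ++ t2.
    by move: tuv; rewrite tE t1E -catA => /eqP; rewrite eqseq_cat // eqxx => /eqP.
  have v1l : subseq v1 l by apply: subseq_trans t1l; rewrite t1E suffix_subseq.
  have ul : subseq (x :: u) l by apply: subseq_trans t1l; rewrite t1E prefix_subseq.
  have t2v : {subset t2 <= v} by move=> y yt; rewrite vE mem_cat yt orbT.
  rewrite vE in sv.
  case: (sorted_split _ _ sv v1l t2r) => [[v10 t2r']|t20|t2top].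
  - constructor 3; apply/andP; split.
      by apply: (occurs_inc_of _ (x :: u)); rewrite ?szu.
    apply: (occurs_inc_of _ t2); rewrite ?(cat_sorted2 sv).2 //.
    by rewrite -szv vE v10.
  - by constructor 1; apply/occursP; exists t => //; rewrite tE t20 cats0.
  - have /v_top : top \in v by apply: t2v; rewrite t2top mem_head.
    by rewrite ltnn.
(* The upper block reaches into top :: r, hence the lower block, being below top,
   lies in r. *)
have uE : x :: u = t1 ++ drop (size t1) (x :: u).
  rewrite -{1}(cat_take_drop (size t1) (x :: u)); congr (_ ++ _).
  by rewrite -(takel_cat v) ?(ltnW lt1) // -tuv tE take_size_cat.
move: uE; set u2 := drop _ _ => uE.
have t2E : t2 = u2 ++ v.
  by move: tE; rewrite tuv uE -catA => /eqP; rewrite eqseq_cat // eqxx => /eqP.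
have u2r : subseq u2 (top :: r) by apply: subseq_trans t2r; rewrite t2E prefix_subseq.
have vr : subseq v r.
  apply: (subseq_cons_lt v top) => //.
  by apply: subseq_trans t2r; rewrite t2E suffix_subseq.
have incv : occurs (iota 1 d.+1) r by apply: (occurs_inc_of _ v); rewrite ?szv.
have su' := su; rewrite uE in su'.
case: (sorted_split _ _ su' t1l u2r) => [[t10 u2r']|u20|u2top].
- constructor 2; apply/occursP; exists t => //; rewrite tE t10 t2E /=.
  case: u2 {u2r su'} uE t2E u2r' => [|z u2] uE t2E u2r'; first by rewrite uE t10 in lt1.
  have zlt : z <> top by move=> ztop; have := r_top z (mem_subseq u2r' (mem_head _ _)); lia.
  by move: t2r; rewrite t2E /= (introF eqP zlt).
- by move: lt1; rewrite uE u20 cats0 ltnn.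
- constructor 3; rewrite incv andbT; apply: (occurs_inc_of _ t1) => //.
    exact: (cat_sorted2 su').1.
  by move: szu; rewrite uE u2top size_cat addn1 => -[<-].
Qed.
End Split.

(** An entry of [l] below an entry of [r] would form 132 with [top] between them.
Conversely, [top] cannot be the 1 or the 2 of an occurrence, and if all of [l]
lies above [r] then no 1 in [l] has its 2 in [r]. *)
Lemma occurs_132_split (l r : seq nat) (top : nat) :
    {in l, forall x, x < top} -> {in r, forall x, x < top} -> uniq (l ++ r) ->
  reflect [/\ ~~ occurs pat132 l, ~~ occurs pat132 r & {in l & r, forall x y, y < x}]
    (~~ occurs pat132 (l ++ top :: r)).
Proof.
move=> lt rt; rewrite cat_uniq => /and3P[_ /hasPn nlr _].
apply: (iffP idP) => [av|[avl avr lr]].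
  split.
  - by apply: contra av; apply: occurs_sub; apply: prefix_subseq.
  - apply: contra av; apply: occurs_sub; apply: subseq_trans (suffix_subseq _ _).
    exact: subseq_cons.
  - move=> x y xl yr; rewrite ltnNge leq_eqVlt; apply/negP => /orP[/eqP xy|xy].
      by have := nlr _ yr; rewrite /= -xy xl.
    move/negP: av; apply; apply/occursP; exists [:: x; top; y].
      apply: (@cat_subseq _ [:: x] [:: top; y]); rewrite ?sub1seq //=.
      by rewrite eqxx sub1seq.
    by apply/order_iso_132; exists x, top, y; split=> //; apply: rt.
apply/negP => /occursP[t /subseq_catP[t1 [t2 [tE t1l t2r]]] /[dup] iso].
move=> /order_iso_132[x [y [z [tE' xz zy]]]].
have below_top a b : a \in top :: r -> b \in top :: r -> a < b -> a \in r.
  rewrite !inE => /orP[/eqP -> /orP[/eqP ->|/rt]|//]; lia.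
case: t1 => [|a [|b [|c t1]]] in tE t1l; rewrite tE /= in tE'.
- have t2E : t2 = [:: x; y; z] by [].
  move/negP: avr; apply; apply/occursP; exists t2; last by rewrite tE in iso.
  move: t2r; rewrite t2E /=; case: eqP => // xtop.
  move=> /mem_subseq /(_ z); rewrite !inE eqxx orbT => /(_ isT)/rt; lia.
- move: tE' => [aE t2E]; rewrite aE t2E in t1l t2r.
  have zr : z \in r.
    by apply: (below_top z y) => //; apply: (mem_subseq t2r); rewrite !inE eqxx ?orbT.
  by have := lr x z (mem_subseq t1l (mem_head _ _)) zr; lia.
- move: tE' => [aE bE t2E]; rewrite aE bE t2E in t1l t2r.
  have xl : x \in l by apply: (mem_subseq t1l); rewrite mem_head.
  have yl : y \in l by apply: (mem_subseq t1l); rewrite !inE eqxx orbT.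
  move: t2r; rewrite sub1seq inE => /orP[/eqP ztop|zr]; first by have := lt y yl; lia.
  by have := lr x z xl zr; lia.
- move: tE' => [_ _ _ t2E].
  have /nilP t20 : nilp t2 by rewrite /nilp; case: (t1) t2E => // /(congr1 size); case: (t2).
  move/negP: avl; apply; apply/occursP; exists t => //.
  by rewrite tE t20 cats0.
Qed.

Lemma occurs_block_upper c d w : occurs (pat (c + d) d) w -> occurs (iota 1 c) w.
Proof.
move=> /occursP[t tw /order_iso_block[u [v [tE [szu _] su _ _]]]].
apply: (occurs_inc_of _ u) => //; last by rewrite szu.
by apply: subseq_trans tw; rewrite tE prefix_subseq.
Qed.

Lemma occurs_block_lower c d w : occurs (pat (c + d) d) w -> occurs (iota 1 d) w.
Proof.
move=> /occursP[t tw /order_iso_block[u [v [tE [_ szv] _ sv _]]]].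
apply: (occurs_inc_of _ v) => //; last by rewrite szv.
by apply: subseq_trans tw; rewrite tE suffix_subseq.
Qed.

(** * Words of permutations, inversions and signs *)

Fixpoint inversions (w : seq nat) : nat :=
  if w is x :: w' then count (fun y => y < x) w' + inversions w' else 0.

Lemma inversions_map (f : nat -> nat) w : {mono f : x y / x < y} ->
  inversions (map f w) = inversions w.
Proof.
move=> fm; elim: w => //= x w ->; congr (_ + _); rewrite count_map.
by apply: eq_count => y /=; rewrite fm.
Qed.

Lemma order_iso_map (f : nat -> nat) t tau : {mono f : x y / x < y} ->
  order_iso (map f t) tau <-> order_iso t tau.
Proof.
move=> fm; rewrite /order_iso size_map; split=> -[sz iso]; split=> // i j hi hj.
  by rewrite -(iso i j) // !(nth_map 0) ?sz // fm.
by rewrite -(iso i j) // !(nth_map 0) ?sz // fm.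
Qed.

Lemma occurs_map (f : nat -> nat) tau w : {mono f : x y / x < y} ->
  occurs tau (map f w) = occurs tau w.
Proof.
move=> fm; apply/occursP/occursP => [[t /subseqP[m _ ->]]|[t tw]].
  rewrite -map_mask => /(order_iso_map _ _ _ fm) iso.
  by exists (mask m w) => //; apply: mask_subseq.
by move=> /(order_iso_map _ _ _ fm) iso; exists (map f t) => //; apply: map_subseq.
Qed.

Lemma perm_word n (s : 'S_n) : perm_eq (word s) (iota 0 n).
Proof.
apply: uniq_perm; last first.
- move=> v; rewrite mem_iota /= add0n; apply/mapP/idP => [[i _ ->]|vn]; first exact: ltn_ord.
  by exists ((s^-1)%g (Ordinal vn)); rewrite ?mem_enum ?permKV.
- exact: iota_uniq.
by rewrite map_inj_uniq ?enum_uniq // => i j /val_inj/perm_inj.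
Qed.

Lemma word_inj n : injective (@word n).
Proof.
move=> s t /eq_in_map st; apply/permP => i; apply: val_inj.
by apply: st; rewrite mem_enum.
Qed.

(** Both lists are duplicate-free, the first is contained in the second, and they have
n! elements each. *)
Lemma perm_words n :
  perm_eq [seq word s | s <- enum {: 'S_n}] (permutations (iota 0 n)).
Proof.
have U : uniq [seq word s | s <- enum {: 'S_n}].
  by rewrite map_inj_uniq ?enum_uniq //; apply: word_inj.
apply: uniq_perm => //; first exact: permutations_uniq.
apply: (uniq_min_size U _ _).2 => [w /mapP[s _ ->]|].
  by rewrite mem_permutations perm_word.
rewrite size_permutations ?iota_uniq // size_iota size_map -cardE.
by rewrite card_Sn.
Qed.

(** Deleting the first letter and closing the gap that its value leaves. *)
Lemma lift_perm_surj n (s : 'S_n.+1) :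
  exists s' : 'S_n, s = lift_perm ord0 (s ord0) s'.
Proof.
pose f i := odflt i (unlift (s ord0) (s (lift ord0 i))).
have fE i : lift (s ord0) (f i) = s (lift ord0 i).
  have ne : s ord0 != s (lift ord0 i) by rewrite (inj_eq perm_inj) neq_lift.
  by rewrite /f; have [j -> ->] := unlift_some ne.
have f_inj : injective f.
  by move=> i j fij; apply/(@lift_inj _ ord0)/(@perm_inj _ s); rewrite -!fE fij.
exists (perm f_inj); apply/permP => i.
case: (unliftP ord0 i) => [j ->|->]; last by rewrite lift_perm_id.
by rewrite lift_perm_lift permE fE.
Qed.

Lemma bump_mono h : {mono bump h : x y / x < y}.
Proof. by move=> x y; rewrite !ltnNge leq_bump2. Qed.

Lemma count_ltn_iota j n : j <= n -> count (fun y => y < j) (iota 0 n) = j.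
Proof.
move=> jn; rewrite -(subnKC jn) iotaD count_cat add0n.
have /eqP -> : count (fun y => y < j) (iota 0 j) == size (iota 0 j).
  by rewrite -all_count; apply/allP => x; rewrite mem_iota.
rewrite size_iota (@eq_in_count _ _ pred0) ?count_pred0 ?addn0 // => x.
by rewrite mem_iota /= => /andP[jx _]; apply/negbTE; rewrite -leqNgt.
Qed.

(** By induction on the first letter j: it exceeds exactly j later letters, and
inserting it changes the sign by the parity of j ([odd_lift_perm]). *)
Lemma odd_perm_inversions n (s : 'S_n) : odd_perm s = odd (inversions (word s)).
Proof.
elim: n s => [|n IH] s.
  rewrite /word (size0nil (size_enum_ord 0)) /=.
  have -> : s = 1%g by apply/permP => -[].
  exact: odd_perm1.
have [s' sE] := lift_perm_surj _ s; move: (s ord0) sE => j ->.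
rewrite odd_lift_perm /word enum_ordSl /= lift_perm_id.
have -> : [seq val (lift_perm ord0 j s' k) | k <- [seq lift ord0 i | i <- enum 'I_n]]
   = map (bump j) (word s').
  by rewrite /word -!map_comp; apply: eq_map => i /=; rewrite lift_perm_lift.
rewrite inversions_map ?oddD ?IH; last exact: bump_mono.
congr (odd _ (+) _); rewrite count_map (@eq_count _ _ (fun y => y < j)); last first.
  by move=> x /=; rewrite /bump; case: (leqP j x) => jx; lia.
rewrite (seq.permP (perm_word _ s')) count_ltn_iota //.
by rewrite -ltnS.
Qed.

(** * The recursive structure of 132-avoiding words *)

Definition avoiders132 n := [seq w <- permutations (iota 0 n) | ~~ occurs pat132 w].

(** The inverse of cutting a 132-avoiding permutation at its largest entry: the values of
[l] are shifted above those of [r]. *)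
Definition skew_join (l r : seq nat) : seq nat :=
  map (addn (size r)) l ++ size l + size r :: r.

Lemma mem_avoiders132 n w : (w \in avoiders132 n) =
  perm_eq w (iota 0 n) && ~~ occurs pat132 w.
Proof. by rewrite mem_filter mem_permutations andbC. Qed.

Lemma add_mono b : {mono addn b : x y / x < y}.
Proof. by move=> x y; rewrite ltn_add2l. Qed.

Lemma perm_iota_lt w n x : perm_eq w (iota 0 n) -> x \in w -> x < n.
Proof. by move=> /perm_mem ->; rewrite mem_iota. Qed.

(** Besides those inside [l] and [r], the inversions are all pairs of an entry of
[l] or the top with an entry of [r]. *)
Lemma inversions_split (l r : seq nat) (t : nat) :
    {in l, forall x, x < t} -> {in r, forall x, x < t} ->
    {in l & r, forall x y, y < x} ->
  inversions (l ++ t :: r) = inversions l + inversions r + size r * (size l).+1.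
Proof.
elim: l => [|x l IH] lt rt lr /=.
  rewrite add0n muln1 addnC; congr (_ + _); apply/eqP.
  by rewrite -all_count; apply/allP.
have lt' : {in l, forall y, y < t} by move=> y yl; apply: lt; rewrite inE yl orbT.
have lr' : {in l & r, forall y z, z < y}.
  by move=> y z yl; apply: lr; rewrite inE yl orbT.
rewrite IH //.
rewrite count_cat /=; have -> : (t < x) = false.
  by apply/negbTE; rewrite -leqNgt ltnW // lt ?mem_head.
have /eqP -> : count (fun y => y < x) r == size r.
  by rewrite -all_count; apply/allP => y; apply: lr; rewrite mem_head.
by rewrite [in RHS]mulnS add0n addnACA !addnA.
Qed.

Section Join.
Variables (a b : nat) (l r : seq nat).
Hypotheses (pl : perm_eq l (iota 0 a)) (pr : perm_eq r (iota 0 b)).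

Lemma size_skew_join_l : size l = a. Proof. by rewrite (perm_size pl) size_iota. Qed.
Lemma size_skew_join_r : size r = b. Proof. by rewrite (perm_size pr) size_iota. Qed.

Lemma skew_join_l_top : {in map (addn (size r)) l, forall x, x < size l + size r}.
Proof.
move=> x /mapP[y yl ->]; rewrite addnC ltn_add2r size_skew_join_l.
exact: (perm_iota_lt _ _ _ pl).
Qed.
Lemma skew_join_r_top : {in r, forall x, x < size l + size r}.
Proof.
by move=> x xr; rewrite ltn_addl // size_skew_join_r (perm_iota_lt _ _ _ pr).
Qed.
Lemma skew_join_lr : {in map (addn (size r)) l & r, forall x y, y < x}.
Proof.
move=> x y /mapP[z zl ->] yr; rewrite ltn_addr // size_skew_join_r.
exact: (perm_iota_lt _ _ _ pr).
Qed.

Lemma perm_skew_join : perm_eq (skew_join l r) (iota 0 (a + b).+1).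
Proof.
rewrite /skew_join size_skew_join_l size_skew_join_r -[(a + b).+1]addn1 iotaD add0n /= cats1.
rewrite -cat1s perm_catCA cat1s perm_sym perm_rcons perm_cons perm_sym.
rewrite addnC iotaD add0n perm_catC; apply: perm_cat => //.
by rewrite -{2}(addn0 b) iotaDl perm_map.
Qed.

Lemma inversions_skew_join :
  inversions (skew_join l r) = inversions l + inversions r + size r * (size l).+1.
Proof.
rewrite /skew_join.
rewrite (inversions_split _ _ _ skew_join_l_top skew_join_r_top skew_join_lr) size_map.
by rewrite (inversions_map _ l (add_mono (size r))).
Qed.

Lemma uniq_skew_join : uniq (map (addn (size r)) l ++ r).
Proof.
have : uniq (skew_join l r) by rewrite (perm_uniq perm_skew_join) iota_uniq.
by rewrite /skew_join -cat1s uniq_catCA cat1s /= => /andP[].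
Qed.

Lemma occurs_132_skew_join :
  occurs pat132 (skew_join l r) = occurs pat132 l || occurs pat132 r.
Proof.
apply: negb_inj; rewrite negb_or -(occurs_map _ _ l (add_mono (size r))).
apply/(occurs_132_split _ _ _ skew_join_l_top skew_join_r_top uniq_skew_join)/andP
  => [[]|[]] //.
by move=> *; split=> //; apply: skew_join_lr.
Qed.

Lemma occurs_inc_skew_join m : occurs (iota 1 m.+1) (skew_join l r) =
  occurs (iota 1 m) l || occurs (iota 1 m.+1) r.
Proof.
rewrite (occurs_inc_split _ _ _ skew_join_l_top skew_join_r_top skew_join_lr).
by rewrite (occurs_map _ _ l (add_mono (size r))).
Qed.

Lemma occurs_block_skew_join c d : occurs (pat (c.+1 + d.+1) d.+1) (skew_join l r) =
  [|| occurs (pat (c.+1 + d.+1) d.+1) l, occurs (pat (c.+1 + d.+1) d.+1) r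
    | occurs (iota 1 c) l && occurs (iota 1 d.+1) r].
Proof.
rewrite (occurs_block_split _ _ _ skew_join_l_top skew_join_r_top skew_join_lr).
by rewrite !(occurs_map _ _ l (add_mono (size r))).
Qed.
End Join.

(** Cutting at the largest value leaves two words with disjoint ranges of values, the
first above the second; hence the second uses the smallest values. *)
Lemma skew_join_decomp n w : w \in avoiders132 n.+1 -> exists l r : seq nat,
  [/\ size l + size r = n, w = skew_join l r, l \in avoiders132 (size l)
    & r \in avoiders132 (size r)].
Proof.
rewrite mem_avoiders132 => /andP[pw].
have : n \in w by rewrite (perm_mem pw) mem_iota /=.
move=> nw; case/splitPr: nw pw => l' r pw.
have plr : perm_eq (l' ++ r) (iota 0 n).
  move: pw; rewrite -cat1s perm_catCA cat1s -[n.+1]addn1 iotaD add0n /= cats1.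
  by rewrite perm_sym perm_rcons perm_cons perm_sym.
have U : uniq (l' ++ r) by rewrite (perm_uniq plr) iota_uniq.
have lt_n x : x \in l' ++ r -> x < n by apply: perm_iota_lt.
have l_top : {in l', forall x, x < n}.
  by move=> x xl; apply: lt_n; rewrite mem_cat xl.
have r_top : {in r, forall x, x < n}.
  by move=> x xl; apply: lt_n; rewrite mem_cat xl orbT.
case/(occurs_132_split _ _ _ l_top r_top U) => avl avr lr.
have sz : size r + size l' = n by rewrite addnC -size_cat (perm_size plr) size_iota.
have : sort leq r ++ sort leq l' = iota 0 (size r) ++ iota (size r) (size l').
  rewrite -iotaD sz; apply: (sorted_eq leq_trans anti_leq).
  - rewrite (sorted_pairwise leq_trans) pairwise_cat -!(sorted_pairwise leq_trans).
    rewrite !(sort_sorted leq_total) !andbT; apply/allrelP => x y.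
    by rewrite !mem_sort => xr yl; apply/ltnW/lr.
  - exact: iota_sorted.
  rewrite perm_catC; apply: perm_trans plr; apply: perm_cat; exact: permEl (perm_sort _ _).
move=> /eqP; rewrite eqseq_cat ?size_sort ?size_iota // => /andP[/eqP sr /eqP sl].
have pr : perm_eq r (iota 0 (size r)) by rewrite -sr perm_sym perm_sort.
have pl' : perm_eq l' (iota (size r) (size l')) by rewrite -sl perm_sym perm_sort.
pose l := map (subn^~ (size r)) l'.
have lE : map (addn (size r)) l = l'.
  rewrite -map_comp -[RHS]map_id; apply/eq_in_map => x /=.
  by rewrite (perm_mem pl') mem_iota => /andP[bx _]; rewrite subnKC.
have szl : size l = size l' by rewrite size_map.
exists l, r; split.
- by rewrite szl addnC.
- by rewrite /skew_join lE szl addnC sz.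
- rewrite mem_avoiders132 -(occurs_map _ _ _ (add_mono (size r))) lE avl andbT szl.
  have := perm_map (subn^~ (size r)) pl'.
  have -> : iota (size r) (size l') = map (addn (size r)) (iota 0 (size l')).
    by rewrite -iotaDl addn0.
  rewrite -/l -(map_comp _ (addn _)) (@eq_map _ _ _ id) ?map_id // => x /=.
  exact: addKn.
- by rewrite mem_avoiders132 pr avr.
Qed.

(** The position of the largest value recovers the size of the left part. *)
Lemma skew_join_inj (a b a' b' : nat) (l r l' r' : seq nat) :
  l \in avoiders132 a -> r \in avoiders132 b ->
  l' \in avoiders132 a' -> r' \in avoiders132 b' ->
  skew_join l r = skew_join l' r' -> a = a' /\ (l, r) = (l', r').
Proof.
rewrite !mem_avoiders132 => /andP[pl _] /andP[pr _] /andP[pl' _] /andP[pr' _] E.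
have sz : size l + size r = size l' + size r'.
  by move: (congr1 size E); rewrite /skew_join !size_cat /= !size_map !addnS => -[].
have index_skew_join c d u v (pu : perm_eq u (iota 0 c)) (pv : perm_eq v (iota 0 d)) :
    index (size u + size v) (skew_join u v) = size u.
  rewrite index_cat ifN /= ?eqxx ?addn0 ?size_map //.
  by apply/negP => /(skew_join_l_top _ _ _ pu); rewrite ltnn.
have szl : size l = size l'.
  by rewrite -(index_skew_join _ _ _ _ pl pr) -(index_skew_join _ _ _ _ pl' pr') sz E.
have szr : size r = size r' by move: sz; rewrite szl => /addnI.
split; first by rewrite -(size_skew_join_l _ _ pl) -(size_skew_join_l _ _ pl').
move: E; rewrite /skew_join => /eqP; rewrite eqseq_cat ?size_map //.
move=> /andP[/eqP + /eqP[_ ->]].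
by rewrite szr => /(inj_map (@addnI _)) ->.
Qed.

Lemma uniq_avoiders132 n : uniq (avoiders132 n).
Proof. by rewrite filter_uniq ?permutations_uniq. Qed.

(** Unique decomposition of the 132-avoiding permutations at their largest value, as
an equality of multisets, so that sums over them can be rewritten. *)
Lemma perm_avoiders132 n : perm_eq (avoiders132 n.+1)
  [seq skew_join lr.1 lr.2 | a <- iota 0 n.+1,
     lr <- [seq (l, r) | l <- avoiders132 a, r <- avoiders132 (n - a)]].
Proof.
apply: uniq_perm; first exact: uniq_avoiders132.
  apply: allpairs_uniq_dep; first exact: iota_uniq.
    by move=> a _; apply: allpairs_uniq; rewrite ?uniq_avoiders132 // => -[? ?] [? ?].
  move=> p q /allpairsPdep[a [_ [_ /allpairsP[[l r] [al ar ->]] ->]]].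
  move=> /allpairsPdep[a' [_ [_ /allpairsP[[l' r'] [al' ar' ->]] ->]]] /= E.
  by have [-> ->] := skew_join_inj _ _ _ _ _ _ _ _ al ar al' ar' E.
move=> w; apply/idP/allpairsPdep => [/skew_join_decomp[l [r [sz -> al ar]]]|].
  exists (size l), (l, r); split=> //; first by rewrite mem_iota ltnS -sz leq_addr.
  apply/allpairsP; exists (l, r); split=> //=.
  by rewrite -sz addKn.
move=> [a [_ [+ /allpairsP[[l r] [/= al ar ->]] ->]]] /=.
rewrite mem_iota add0n ltnS => /andP[_ an].
move: al ar; rewrite !mem_avoiders132 => /andP[pl avl] /andP[pr avr].
rewrite (occurs_132_skew_join _ _ _ _ pl pr) negb_or avl avr !andbT.
by have := perm_skew_join _ _ _ _ pl pr; rewrite subnKC.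
Qed.

Local Open Scope ring_scope.

(** * Formal power series over the rationals *)

(** A separate name for the type of sequences, so that it carries the convolution
product and not the pointwise operations of functions. *)
Definition fps : Type := nat -> rat.

HB.instance Definition _ := gen_eqMixin fps.
HB.instance Definition _ := gen_choiceMixin fps.

Definition fps_zero : fps := fun=> 0.
Definition fps_opp (a : fps) : fps := fun n => - a n.
Definition fps_add (a b : fps) : fps := fun n => a n + b n.
Definition fps_of_poly (p : {poly rat}) : fps := fun n => p`_n.
Definition fps_mul (a b : fps) : fps :=
  fun n => \sum_(i < n.+1) a i * b (n - i)%N.

Definition fps_trunc (N : nat) (a : fps) : {poly rat} := \poly_(i < N) a i.

Lemma fps_addA : associative fps_add.
Proof. by move=> a b c; apply/funext=> n; rewrite /fps_add addrA. Qed.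
Lemma fps_addC : commutative fps_add.
Proof. by move=> a b; apply/funext=> n; rewrite /fps_add addrC. Qed.
Lemma fps_add0 : left_id fps_zero fps_add.
Proof. by move=> a; apply/funext=> n; rewrite /fps_add add0r. Qed.
Lemma fps_addN : left_inverse fps_zero fps_opp fps_add.
Proof. by move=> a; apply/funext=> n; rewrite /fps_add addNr. Qed.

HB.instance Definition _ :=
  GRing.isZmodule.Build fps fps_addA fps_addC fps_add0 fps_addN.

Lemma coef_fps_trunc N a n : (n < N)%N -> (fps_trunc N a)`_n = a n.
Proof. by move=> nN; rewrite coef_poly nN. Qed.

(** The n-th coefficient of a product depends only on the coefficients up to n;
this transfers associativity from polynomials. *)
Lemma fps_mul_coefM (a b : fps) (p q : {poly rat}) n :
  (forall i, (i <= n)%N -> p`_i = a i) -> (forall i, (i <= n)%N -> q`_i = b i) ->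
  (p * q)`_n = fps_mul a b n.
Proof.
move=> pa qb; rewrite coefM; apply: eq_bigr => i _.
by rewrite pa ?qb ?leq_subr // -ltnS.
Qed.

Lemma fps_mulA : associative fps_mul.
Proof.
move=> a b c; apply/funext=> n.
have T u i : (i <= n)%N -> (fps_trunc n.+1 u)`_i = u i.
  by move=> lein; rewrite coef_fps_trunc.
rewrite -(fps_mul_coefM _ _ (fps_trunc n.+1 a)
            (fps_trunc n.+1 b * fps_trunc n.+1 c)) ?mulrA; last 2 first.
- exact: T.
- by move=> i ni; apply: fps_mul_coefM => j ij; apply: T; apply: leq_trans ni.
apply: fps_mul_coefM => // i ni; last exact: T.
by apply: fps_mul_coefM => j ij; apply: T; apply: leq_trans ni.
Qed.

Lemma fps_mulC : commutative fps_mul.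
Proof.
move=> a b; apply/funext=> n; rewrite /fps_mul [RHS](reindex_inj rev_ord_inj) /=.
by apply: eq_bigr => i _; rewrite mulrC subSS subKn // -ltnS.
Qed.

Lemma fps_mul1 : left_id (fps_of_poly 1) fps_mul.
Proof.
move=> a; apply/funext=> n; rewrite /fps_mul big_ord_recl /fps_of_poly coef1 mul1r.
by rewrite subn0 big1 ?addr0 // => i _; rewrite coef1 mul0r.
Qed.

Lemma fps_mulDl : left_distributive fps_mul fps_add.
Proof.
move=> a b c; apply/funext=> n; rewrite /fps_mul /fps_add -big_split.
by apply: eq_bigr => i _; rewrite mulrDl.
Qed.

Lemma fps_1neq0 : fps_of_poly 1 != fps_zero.
Proof.
by apply/eqP=> /(congr1 (@^~ 0%N))/eqP; rewrite /fps_of_poly coef1 oner_eq0.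
Qed.

HB.instance Definition _ := GRing.Zmodule_isComNzRing.Build fps
  fps_mulA fps_mulC fps_mul1 fps_mulDl fps_1neq0.

Lemma fps_of_poly_is_additive : additive fps_of_poly.
Proof. by move=> p q; apply/funext=> n; rewrite /fps_of_poly coefB. Qed.
Lemma fps_of_poly_is_monoid_morphism : monoid_morphism fps_of_poly.
Proof. by split=> // p q; apply/funext=> n; rewrite /fps_of_poly coefM. Qed.

HB.instance Definition _ := GRing.isZmodMorphism.Build _ _ fps_of_poly
  fps_of_poly_is_additive.
HB.instance Definition _ := GRing.isMonoidMorphism.Build _ _ fps_of_poly
  fps_of_poly_is_monoid_morphism.

Definition fpsX : fps := fps_of_poly 'X.

Lemma fpsD (a b : fps) n : (a + b) n = a n + b n. Proof. by []. Qed.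
Lemma fpsB (a b : fps) n : (a - b) n = a n - b n. Proof. by []. Qed.
Lemma fpsM (a b : fps) n : (a * b) n = \sum_(i < n.+1) a i * b (n - i)%N.
Proof. by []. Qed.
Lemma fps1 n : (1 : fps) n = (n == 0%N)%:R. Proof. exact: coef1. Qed.
Lemma fpsM0 (a b : fps) : (a * b) 0%N = a 0%N * b 0%N.
Proof. by rewrite fpsM big_ord_recl big_ord0 addr0. Qed.
Lemma fpsXM0 (a : fps) : (fpsX * a) 0%N = 0.
Proof. by rewrite fpsM0 /fpsX /fps_of_poly coefX mul0r. Qed.
Lemma fpsXMS (a : fps) n : (fpsX * a) n.+1 = a n.
Proof.
rewrite fpsM !big_ord_recl big1 => [|i _]; rewrite /fpsX /fps_of_poly coefX ?mul0r //.
by rewrite coefX /= mul1r add0r addr0 subSS subn0.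
Qed.

(** A series with constant term 1 is cancellable. This replaces division in all the
equations below. *)
Lemma fps_lregP (u a b : fps) : u 0%N = 1 -> u * a = u * b -> a = b.
Proof.
move=> u0 /eqP; rewrite -subr_eq0 -mulrBr => /eqP uab.
apply/eqP; rewrite -subr_eq0; move: (a - b) uab => c uc.
apply/eqP/funext => n; elim/ltn_ind: n => n IH.
have := congr1 (@^~ n) uc; rewrite fpsM big_ord_recl u0 mul1r subn0 big1 ?addr0 //.
by move=> i _; rewrite IH ?mulr0 // lift0 ltn_subrL; case: n i {IH} => [[]|].
Qed.

(** * Twisted products and parity of degrees *)

Definition even_part (a : fps) : fps := fun n => if odd n then 0 else a n.
Definition odd_part (a : fps) : fps := fun n => if odd n then a n else 0.

(** The exponent b (a + 1), for factors of degrees a and b = n - a, counts the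
inversions created by [skew_join]. *)
Definition twist (a b : fps) : fps :=
  fun n => \sum_(i < n.+1) (-1) ^+ (odd ((n - i) * i.+1)) * (a i * b (n - i)%N).

Lemma even_part_add_odd_part a : even_part a + odd_part a = a.
Proof.
apply/funext=> n; rewrite fpsD /even_part /odd_part.
by case: ifP; rewrite ?add0r ?addr0.
Qed.

(** In even degree n the indices a and b have the same parity, so b (a + 1) is even
and all signs are positive. *)
Lemma even_part_twist a b :
  even_part (twist a b) = even_part a * even_part b + odd_part a * odd_part b.
Proof.
apply/funext=> n; rewrite fpsD !fpsM -big_split /even_part /odd_part /twist.
have -> (S : rat) : (if odd n then 0 else S) = (~~ odd n)%:R * S.
  by case: odd; rewrite ?mul0r ?mul1r.
rewrite mulr_sumr; apply: eq_bigr => i _.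
have -> : odd n = odd (n - i) (+) odd i by rewrite oddB ?addbK // -ltnS.
rewrite oddM /=; case: (odd i); case: (odd (n - i));
  by rewrite /= ?(mul0r, mulr0, mul1r, add0r, addr0) ?expr0 ?mul1r.
Qed.

(** In odd degree n the sign is negative exactly when a is even and b is odd. *)
Lemma odd_part_twist a b :
  odd_part (twist a b) = odd_part a * even_part b - even_part a * odd_part b.
Proof.
apply/funext=> n; rewrite fpsB !fpsM -sumrB /even_part /odd_part /twist.
have -> (S : rat) : (if odd n then S else 0) = (odd n)%:R * S.
  by case: odd; rewrite ?mul0r ?mul1r.
rewrite mulr_sumr; apply: eq_bigr => i _.
have -> : odd n = odd (n - i) (+) odd i by rewrite oddB ?addbK // -ltnS.
rewrite oddM /=; case: (odd i); case: (odd (n - i));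
  by rewrite /= ?(mul0r, mulr0, mul1r, subr0, sub0r) ?expr0 ?mul1r // expr1 mulN1r.
Qed.

Lemma even_partD a b : even_part (a + b) = even_part a + even_part b.
Proof. by apply/funext=> n; rewrite fpsD /even_part; case: odd; rewrite ?addr0. Qed.
Lemma odd_partD a b : odd_part (a + b) = odd_part a + odd_part b.
Proof. by apply/funext=> n; rewrite fpsD /odd_part; case: odd; rewrite ?addr0. Qed.
Lemma even_partB a b : even_part (a - b) = even_part a - even_part b.
Proof. by apply/funext=> n; rewrite fpsB /even_part; case: odd; rewrite ?subr0. Qed.
Lemma odd_partB a b : odd_part (a - b) = odd_part a - odd_part b.
Proof. by apply/funext=> n; rewrite fpsB /odd_part; case: odd; rewrite ?subr0. Qed.

Lemma even_part_1DX a : even_part (1 + fpsX * a) = 1 + fpsX * odd_part a.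
Proof.
apply/funext=> -[|n]; rewrite /even_part !fpsD ?fpsXM0 ?fpsXMS //= fps1 /odd_part.
by case: odd; rewrite /= ?addr0.
Qed.
Lemma odd_part_1DX a : odd_part (1 + fpsX * a) = fpsX * even_part a.
Proof.
apply/funext=> -[|n]; rewrite /odd_part ?fpsD ?fpsXM0 ?fpsXMS //= fps1 /even_part.
by case: odd; rewrite /= ?add0r.
Qed.

(** * Functional equations for the signed generating functions *)

(** The weight [c] is rational-valued so that indicators can be added and multiplied. *)
Definition signed_gf (c : seq nat -> rat) : fps :=
  fun n => \sum_(w <- avoiders132 n) (-1) ^+ inversions w * c w.

Lemma avoiders132_0 : avoiders132 0 = [:: [::]].
Proof.
apply: perm_small_eq => //; apply: uniq_perm; rewrite ?uniq_avoiders132 // => w.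
rewrite mem_avoiders132 inE -size_eq0; apply/andP/eqP => [[/perm_size //]|/size0nil ->].
split=> //; apply/negP => /occursP[t]; rewrite subseq0 => /eqP -> /order_iso_132.
by move=> [? [? [? []]]].
Qed.

Lemma signed_gf0 c : signed_gf c 0%N = c [::].
Proof. by rewrite /signed_gf avoiders132_0 big_seq1 mul1r. Qed.

(** If a statistic is a sum of products of statistics of the two parts, its series
is a sum of twisted products. The list [s] holds the terms, as triples of a scalar
and two statistics. *)
Lemma signed_gf_rec (c : seq nat -> rat)
    (s : seq (rat * (seq nat -> rat) * (seq nat -> rat))) :
    (forall a b l r, perm_eq l (iota 0 a) -> perm_eq r (iota 0 b) ->
       c (skew_join l r) = \sum_(t <- s) t.1.1 * (t.1.2 l * t.2 r)) ->
  forall n, signed_gf c n.+1 =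
    \sum_(t <- s) t.1.1 * twist (signed_gf t.1.2) (signed_gf t.2) n.
Proof.
move=> cE n; rewrite /signed_gf (perm_big _ (perm_avoiders132 n)) big_allpairs_dep.
rewrite -{1}[n.+1]subn0 -/(index_iota 0 n.+1) big_mkord.
rewrite (eq_bigr _ (fun i _ => mulr_sumr _ _ _ _)) exchange_big.
apply: eq_bigr => a _; rewrite big_allpairs_dep /=.
under [RHS]eq_bigr => t _ do rewrite big_distrlr !mulr_sumr.
rewrite [RHS]exchange_big; apply: eq_big_seq => l; rewrite mem_avoiders132 => /andP[pl _].
under [RHS]eq_bigr => t _ do rewrite !mulr_sumr.
rewrite [RHS]exchange_big; apply: eq_big_seq => r; rewrite mem_avoiders132 => /andP[pr _].
rewrite (inversions_skew_join _ _ _ _ pl pr) (cE _ _ _ _ pl pr) mulr_sumr.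
apply: eq_bigr => t _; rewrite (size_skew_join_l _ _ pl) (size_skew_join_r _ _ pr).
by rewrite signr_odd !exprD /=; ring.
Qed.

Definition avoidance (tau w : seq nat) : rat := (~~ occurs tau w)%:R.

Lemma M_gfE tau : M_gf tau = signed_gf (avoidance tau).
Proof.
apply/funext => n; rewrite /M_gf /even_gf /odd_gf /signed_gf big_filter.
rewrite -(perm_big _ (perm_words n)) big_map big_mkcond big_enum /=.
have cardE (P : pred 'S_n) : #|[set s | P s]|%:R = \sum_s (P s)%:R :> rat.
  rewrite -sum1_card natr_sum big_mkcond; apply: eq_bigr => s _.
  by rewrite inE; case: (P s).
rewrite !cardE -sumrB; apply: eq_bigr => s _.
rewrite /avoids !contains_word odd_perm_inversions -(signr_odd _ (inversions _)) /avoidance.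
by case: odd; case: occurs; case: occurs; rewrite /= ?expr0 ?expr1; ring.
Qed.

Lemma occurs_inc0 w : occurs (iota 1 0) w.
Proof. by apply/occursP; exists [::]; rewrite ?sub0seq. Qed.

Lemma avoidance_nil x tau : avoidance (x :: tau) [::] = 1.
Proof.
rewrite /avoidance; case: occursP => // -[t]; rewrite subseq0 => /eqP -> [].
by [].
Qed.

Lemma signed_gf_inc0 : signed_gf (avoidance (iota 1 0)) = 0.
Proof.
apply/funext => n; rewrite /signed_gf big1 // => w _.
by rewrite /avoidance occurs_inc0 mulr0.
Qed.

(** The word must have left part avoiding 12...m and right part avoiding 12...(m+1). *)
Lemma signed_gf_incS m : signed_gf (avoidance (iota 1 m.+1)) =
  1 + fpsX * twist (signed_gf (avoidance (iota 1 m))) (signed_gf (avoidance (iota 1 m.+1))).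
Proof.
apply/funext => -[|n]; rewrite fpsD fps1 ?fpsXM0 ?fpsXMS.
  by rewrite signed_gf0 avoidance_nil addr0.
rewrite add0r (signed_gf_rec _ [:: (1, avoidance (iota 1 m), avoidance (iota 1 m.+1))]).
  by rewrite big_seq1 mul1r.
move=> a b l r pl pr; rewrite big_seq1 mul1r /avoidance (occurs_inc_skew_join _ _ _ _ pl pr).
by rewrite negb_or -natrM mulnb.
Qed.

(** Inclusion-exclusion over the two ways of excluding an occurrence that uses both
parts: the upper block is missing on the left (not [u]) or the lower one on the
right (not [v]). Not [u] already implies not [x], and not [v] implies not [y]. *)
Lemma indicator_split (x y u v : bool) : (x -> u) -> (y -> v) ->
  (~~ [|| x, y | u && v])%:R =
  (~~ u)%:R * (~~ y)%:R + ((~~ x)%:R * (~~ v)%:R - (~~ u)%:R * (~~ v)%:R) :> rat.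
Proof.
by case: x; case: y; case: u; case: v => xu yv;
  first [by have := xu isT | by have := yv isT | rewrite /=; ring].
Qed.

(** The pattern is avoided iff both parts avoid it and, moreover, the left part avoids
the shortened upper block or the right part avoids the lower block. *)
Lemma signed_gf_block c d (tau := pat (c.+1 + d.+1) d.+1)
    (f := signed_gf (avoidance (iota 1 c))) (g := signed_gf (avoidance (iota 1 d.+1))) :
  signed_gf (avoidance tau) =
  1 + fpsX * (twist f (signed_gf (avoidance tau)) + twist (signed_gf (avoidance tau)) g
           - twist f g).
Proof.
apply/funext => -[|n]; rewrite fpsD fps1 ?fpsXM0 ?fpsXMS.
  by rewrite signed_gf0 /tau /pat addnK avoidance_nil addr0.
rewrite add0r (signed_gf_rec _ [:: (1, avoidance (iota 1 c), avoidance tau);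
  (1, avoidance tau, avoidance (iota 1 d.+1));
  (-1, avoidance (iota 1 c), avoidance (iota 1 d.+1))]).
  by rewrite !big_cons big_nil /= !mul1r addr0 mulN1r addrA.
move=> a b l r pl pr; rewrite !big_cons big_nil /= !mul1r addr0 mulN1r /avoidance.
rewrite (occurs_block_skew_join _ _ _ _ pl pr).
have bu w : occurs tau w -> occurs (iota 1 c) w.
  by move=> /occurs_block_upper; apply: occurs_inc_leq.
have bl w : occurs tau w -> occurs (iota 1 d.+1) w by apply: occurs_block_lower.
exact: indicator_split _ _ _ _ (bu l) (bl r).
Qed.

(** * Convergents of the continued fraction *)

(** Denominators of the continued fraction 1 / (1 - x^2 / (1 - x^2 / ...)); the
numerators [cfP] are the denominators shifted by one index. Starting at
[cfP 0 = 0] gives R_0 = 0, which covers the case k = d. *)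
Fixpoint cfQ (k : nat) : {poly rat} :=
  match k with
  | k'.+1 => if k' is k''.+1 then cfQ k' - 'X^2 * cfQ k'' else 1
  | 0 => 1
  end.
Definition cfP (k : nat) : {poly rat} := if k is k'.+1 then cfQ k' else 0.

Lemma cfQS k : cfQ k.+1 = cfQ k - 'X^2 * cfP k.
Proof. by case: k => //=; rewrite mulr0 subr0. Qed.
Lemma cfPS k : cfP k.+1 = cfQ k. Proof. by []. Qed.
Lemma cfQ_coef0 k : (cfQ k)`_0 = 1.
Proof.
by elim: k => [|k IH]; rewrite ?coef1 // cfQS coefB coef0M IH coefXn mul0r subr0.
Qed.

(** Addition formula for the convergents r_k = P_k / Q_k, the analogue of the addition
formula of Chebyshev polynomials:
r_(e+d) = (r_e + r_d - r_e r_d) / (1 - x^2 r_e r_d). *)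
Lemma cf_add d e : cfQ (e + d) = cfQ e * cfQ d - 'X^2 * (cfP e * cfP d) /\
  cfP (e + d) = cfP e * cfQ d + cfQ e * cfP d - cfP e * cfP d.
Proof.
elim: d => [|d [IHq IHp]].
  by rewrite addn0 /=; split; ring.
by rewrite addnS !cfPS !cfQS IHq IHp; split; ring.
Qed.

(** Multiplying U_k(1 / (2 s)) by s^k turns the Chebyshev recurrence into
q_(k+2) = q_(k+1) - s^2 q_k. *)
Lemma chebU_rec_uniq (K : fieldType) (s : K) (q : nat -> K) :
    2%:R != 0 :> K -> s != 0 -> q 0%N = 1 -> q 1%N = 1 ->
    (forall k, q k.+2 = q k.+1 - s ^+ 2 * q k) ->
  forall k, s ^+ k * (chebU K k).[(2%:R * s)^-1] = q k.
Proof.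
move=> n2 s0 q0 q1 qS k.
have [U0 U1 US] := chebU_horner (2%:R * s)^-1.
suff: s ^+ k * (chebU _ k).[(2%:R * s)^-1] = q k /\
  s ^+ k.+1 * (chebU _ k.+1).[(2%:R * s)^-1] = q k.+1 by case.
elim: k => [|k [IH1 IH2]].
  by rewrite U0 U1 q0 q1; split; [rewrite expr0 mul1r|field; rewrite ?n2 ?s0].
split=> //; rewrite US qS -IH1 -IH2 !exprS.
by field; rewrite ?n2 ?s0.
Qed.

Lemma varX_neq0 : varX != 0.
Proof. by rewrite tofrac_eq0 polyX_eq0. Qed.

Lemma chebU_cfQ k :
  varX ^+ k * (chebU ratfun k).[(2%:R * varX)^-1] = tofrac (cfQ k).
Proof.
apply: (@chebU_rec_uniq ratfun varX (fun k => tofrac (cfQ k))).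
- by rewrite -(rmorph_nat (@tofrac _)) tofrac_eq0 -polyC_natr polyC_eq0.
- exact: varX_neq0.
- exact: rmorph1.
- exact: rmorph1.
- by move=> j; rewrite cfQS cfPS tofracB tofracM tofracXn.
Qed.

Lemma chebR_cf k : (0 < k)%N ->
  chebR k (varX ^+ 2) = tofrac (cfP k) / tofrac (cfQ k).
Proof.
case: k => // k _; rewrite chebRE // cfPS -!chebU_cfQ [k.+1.-1]/=.
rewrite exprSr -[in RHS]mulrA -mulf_div divff ?mul1r //.
by rewrite expf_neq0 // varX_neq0.
Qed.

(** * Solving the functional equations *)

Definition convP k : fps := fps_of_poly (cfP k).
Definition convQ k : fps := fps_of_poly (cfQ k).
(** The common denominator of the two parts of the series of permutations avoiding 132
and 12...(2k). *)
Definition convD k : fps := convQ k ^+ 2 + fpsX ^+ 2 * convP k ^+ 2.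

Lemma convPS k : convP k.+1 = convQ k. Proof. by []. Qed.
Lemma convP0 : convP 0 = 0. Proof. exact: rmorph0. Qed.
Lemma convQS k : convQ k.+1 = convQ k - fpsX ^+ 2 * convP k.
Proof. by rewrite /convQ cfQS rmorphB rmorphM rmorphXn. Qed.
Lemma convQ_at0 k : convQ k 0%N = 1. Proof. exact: cfQ_coef0. Qed.
Lemma convD_at0 k : convD k 0%N = 1.
Proof. by rewrite /convD fpsD !expr2 fpsM0 -mulrA fpsXM0 convQ_at0 mulr1 addr0. Qed.
Lemma convQ_add e d : convQ (e + d) = convQ e * convQ d - fpsX ^+ 2 * (convP e * convP d).
Proof. by rewrite /convQ (cf_add d e).1 rmorphB !rmorphM. Qed.
Lemma convP_add e d :
  convP (e + d) = convP e * convQ d + convQ e * convP d - convP e * convP d.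
Proof. by rewrite /convP (cf_add d e).2 rmorphB rmorphD !rmorphM. Qed.

Lemma even_part0 : even_part 0 = 0. Proof. by rewrite -[0](subr0 0) even_partB subrr. Qed.
Lemma odd_part0 : odd_part 0 = 0. Proof. by rewrite -[0](subr0 0) odd_partB subrr. Qed.

(** Multiplication by x exchanges parities. *)
Lemma parts_1DX_twist (a b c : fps) : c = 1 + fpsX * twist a b ->
  even_part c = 1 + fpsX * (odd_part a * even_part b - even_part a * odd_part b) /\
  odd_part c = fpsX * (even_part a * even_part b + odd_part a * odd_part b).
Proof. by move=> ->; rewrite even_part_1DX odd_part_1DX odd_part_twist even_part_twist. Qed.

Section Increasing.

Variable L : nat -> fps.
Hypothesis L0 : L 0 = 0.
Hypothesis LS : forall m, L m.+1 = 1 + fpsX * twist (L m) (L m.+1).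

(** By induction on e: each step solves a 2 x 2 linear system for the two parts of the
next series. Quotients are cleared, so that cancelling series with constant term 1
suffices. *)
Lemma increasing_parts e :
  [/\ convD e * even_part (L (2 * e)) = convP e * convQ e,
      convD e * odd_part (L (2 * e)) = fpsX * convP e ^+ 2,
      even_part (L (2 * e).+1) = 1 & convQ e * odd_part (L (2 * e).+1) = fpsX * convP e].
Proof.
have odd_step k : convD k * even_part (L (2 * k)) = convP k * convQ k ->
    convD k * odd_part (L (2 * k)) = fpsX * convP k ^+ 2 ->
    even_part (L (2 * k).+1) = 1 /\ convQ k * odd_part (L (2 * k).+1) = fpsX * convP k.
  move=> He Ho; have [] := parts_1DX_twist _ _ _ (LS (2 * k)).
  move: (even_part (L (2 * k).+1)) (odd_part (L (2 * k).+1)) => e2 o2.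
  move: (even_part (L (2 * k))) (odd_part (L (2 * k))) He Ho => e1 o1 He Ho E2 O2.
  have QO : convQ k * o2 = fpsX * convP k * e2.
    apply: (fps_lregP (convQ k)); first exact: convQ_at0.
    have -> : convQ k * (convQ k * o2) =
       convD k * o2 - fpsX * (convD k * o1) * o2 by rewrite Ho /convD; ring.
    rewrite {1}O2.
    have -> : convQ k * (fpsX * convP k * e2) = fpsX * (convD k * e1) * e2.
      by rewrite He; ring.
    ring.
  suff E1 : e2 = 1 by rewrite QO E1 mulr1.
  apply: (fps_lregP (convD k)); first exact: convD_at0.
  have -> : convD k * e2 = convQ k ^+ 2 * e2 + fpsX * convP k * (fpsX * convP k * e2).
    by rewrite /convD; ring.
  rewrite -QO.
  have -> : convQ k ^+ 2 * e2 = convD k * e2 - fpsX * (convD k * o1) * e2.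
    by rewrite Ho /convD; ring.
  rewrite {1}E2.
  have -> : fpsX * convP k * (convQ k * o2) = fpsX * (convD k * e1) * o2.
    by rewrite He; ring.
  by ring.
elim: e => [|e [_ _ IHe IHo]].
  have He : convD 0 * even_part (L (2 * 0)) = convP 0 * convQ 0.
    by rewrite muln0 L0 even_part0 convP0 mulr0 mul0r.
  have Ho : convD 0 * odd_part (L (2 * 0)) = fpsX * convP 0 ^+ 2.
    by rewrite muln0 L0 odd_part0 convP0 expr0n !mulr0.
  by have [] := odd_step 0%N He Ho.
have eL : (2 * e).+2 = (2 * e.+1)%N by rewrite mulnS.
have [] := parts_1DX_twist _ _ _ (LS (2 * e).+1).
rewrite IHe eL.
move: (odd_part (L (2 * e).+1)) IHo => o1 Ho.
move: (even_part (L (2 * e.+1))) (odd_part (L (2 * e.+1))) (odd_step e.+1) => e2 o2 step E2 O2.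
have QO : convQ e.+1 * o2 = fpsX * convP e.+1 * e2.
  have -> : convQ e.+1 * o2 = convQ e * o2 - fpsX * (fpsX * convP e) * o2.
    by rewrite convQS; ring.
  rewrite -Ho {1}O2 convPS; ring.
have He : convD e.+1 * e2 = convP e.+1 * convQ e.+1.
  have -> : convD e.+1 * e2 =
     convQ e.+1 * (convQ e.+1 * e2) + fpsX * convP e.+1 * (fpsX * convP e.+1 * e2).
    by rewrite /convD; ring.
  rewrite -QO.
  have -> : convQ e.+1 * e2 = convQ e * e2 - fpsX * (fpsX * convP e) * e2.
    by rewrite convQS; ring.
  rewrite -Ho {1}E2 convPS; ring.
have Ho' : convD e.+1 * o2 = fpsX * convP e.+1 ^+ 2.
  apply: (fps_lregP (convQ e.+1)); first exact: convQ_at0.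
  by rewrite mulrCA QO mulrCA He; ring.
by have [] := step He Ho'.
Qed.

(** The two parts of [M] solve a 2 x 2 linear system whose determinant has constant term
1, and by the addition formula so do 1 and x P_k / Q_k for k = e + d. *)
Lemma block_parts e d (M : fps) :
    M = 1 + fpsX * (twist (L (2 * e)) M + twist M (L (2 * d))
                 - twist (L (2 * e)) (L (2 * d))) ->
  convQ (e + d) * M = convQ (e + d) + fpsX * convP (e + d).
Proof.
move=> HM.
have EM := congr1 even_part HM; have OM := congr1 odd_part HM.
move: EM OM; rewrite even_part_1DX odd_part_1DX odd_partB even_partB.
rewrite odd_partD even_partD !odd_part_twist !even_part_twist.
have [He Ho _ _] := increasing_parts e; have [Hed Hod _ _] := increasing_parts d.
rewrite -[in convQ _ * M](even_part_add_odd_part M).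
move: (even_part M) (odd_part M) => em om.
move: (even_part (L (2 * e))) (odd_part (L (2 * e))) He Ho => ee oe He Ho.
move: (even_part (L (2 * d))) (odd_part (L (2 * d))) Hed Hod => ed od Hed Hod.
move=> EM OM.
(* The unknowns em and om satisfy A1 em + B1 om = C1 and A2 em + B2 om = C2; the
   candidate solution 1 and x P / Q is checked after clearing the denominator DD. *)
pose A1 := 1 - fpsX * (oe - od); pose B1 := fpsX * (ee - ed).
pose A2 := - fpsX * (ee + ed); pose B2 := 1 - fpsX * (oe + od).
pose C1 := 1 - fpsX * (oe * ed - ee * od).
pose C2 := - fpsX * (ee * ed + oe * od).
have S1 : A1 * em + B1 * om = C1.
  by rewrite /A1 /B1 /C1 mulrBl mul1r {1}EM; ring.
have S2 : A2 * em + B2 * om = C2.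
  by rewrite /A2 /B2 /C2 mulrBl mul1r {1}OM; ring.
pose Q := convQ (e + d); pose P := convP (e + d).
pose DD := convD e * convD d.
have T1 : A1 * Q + B1 * (fpsX * P) = Q * C1.
  apply: (fps_lregP DD); first by rewrite /DD fpsM0 !convD_at0 mulr1.
  have -> : DD * (A1 * Q + B1 * (fpsX * P)) =
     (DD - fpsX * (convD e * oe * convD d - convD e * (convD d * od))) * Q +
      fpsX * (convD e * ee * convD d - convD e * (convD d * ed)) * (fpsX * P).
    by rewrite /A1 /B1 /DD; ring.
  have -> : DD * (Q * C1) = Q * (DD - fpsX * ((convD e * oe) * (convD d * ed) -
     (convD e * ee) * (convD d * od))) by rewrite /C1 /DD; ring.
  rewrite He Ho Hed Hod /DD /convD /Q /P convQ_add convP_add; ring.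
have T2 : A2 * Q + B2 * (fpsX * P) = Q * C2.
  apply: (fps_lregP DD); first by rewrite /DD fpsM0 !convD_at0 mulr1.
  have -> : DD * (A2 * Q + B2 * (fpsX * P)) =
     - fpsX * (convD e * ee * convD d + convD e * (convD d * ed)) * Q +
     (DD - fpsX * (convD e * oe * convD d + convD e * (convD d * od))) * (fpsX * P).
    by rewrite /A2 /B2 /DD; ring.
  have -> : DD * (Q * C2) = Q * (- fpsX * ((convD e * ee) * (convD d * ed) +
     (convD e * oe) * (convD d * od))) by rewrite /C2 /DD; ring.
  rewrite He Ho Hed Hod /DD /convD /Q /P convQ_add convP_add; ring.
apply: (fps_lregP (A1 * B2 - B1 * A2)).
  rewrite fpsB !fpsM0 /A1 /B1 /A2 /B2 !fpsB !mulNr.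
  by rewrite !fpsXM0 fps1 !mul0r !subr0 mulr1.
have -> : (A1 * B2 - B1 * A2) * (convQ (e + d) * (em + om)) =
   Q * ((B2 - A2) * (A1 * em + B1 * om) + (A1 - B1) * (A2 * em + B2 * om)).
  by rewrite /Q; ring.
rewrite S1 S2.
have -> : Q * ((B2 - A2) * C1 + (A1 - B1) * C2) =
   (B2 - A2) * (Q * C1) + (A1 - B1) * (Q * C2) by ring.
by rewrite -T1 -T2 /Q /P; ring.
Qed.
End Increasing.

Theorem theorem2p19 (k d : nat) (hd : (1 <= d)%N) (hdk : (d <= k)%N) :
  series_eq_ratfun (M_gf (pat (2 * k + 1) (2 * d)))
    (1 + varX * chebR k (varX ^+ 2)).
Proof.
have kpos := leq_trans hd hdk.
have tauE : pat (2 * k + 1) (2 * d) =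
    pat ((2 * (k - d)).+1 + (2 * d).-1.+1) (2 * d).-1.+1.
  by congr pat; lia.
have := signed_gf_block (2 * (k - d)) (2 * d).-1.
rewrite -tauE (_ : (2 * d).-1.+1 = 2 * d)%N; last by lia.
move=> /(block_parts _ signed_gf_inc0 signed_gf_incS); rewrite subnK //.
rewrite -M_gfE => QM.
exists (cfQ k + 'X * cfP k), (cfQ k); split=> [||n].
- by rewrite cfQ_coef0 oner_eq0.
- rewrite chebR_cf // tofracD tofracM mulrDl divff ?mulrA //.
  rewrite tofrac_eq0; apply: contra_eq_neq (cfQ_coef0 k) => ->.
  by rewrite coef0 eq_sym oner_eq0.
- rewrite coefD; have := congr1 (@^~ n) QM; rewrite fpsM => ->.
  by rewrite fpsD /convP /fpsX -rmorphM.
Qed.
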